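(* Let $D=(V,A)$ be a digraph, let $uv\in A$, and let $D'=(V,A')$ with $A'=(A\setminus\{uv\})\cup\{vu\}$ (the digraph obtained by reversing the arc $uv$). Then $\gamma^+_{maj}(D)-2\leq \gamma^+_{maj}(D')\leq \gamma^+_{maj}(D)+2$. Moreover, both bounds are sharp (each is attained for some digraph $D$ and arc $uv$).
   Context: Digraphs are finite, without loops or multiple arcs (pairs of opposite arcs allowed). For $u\in V$, $N^+[u]=\{u\}\cup\{v: uv\in A\}$. For $f:V\to\{-1,1\}$ and $X\subseteq V$, $f(X)=\sum_{v\in X}f(v)$. A majority out-dominating function (MODF) of $D$ is a function $f:V\to\{-1,1\}$ with $|\{v\in V: f(N^+[v])\geq1\}|\geq |V|/2$; its weight is $w(f)=f(V)$. $\gamma^+_{maj}(D)$ is the minimum weight of a MODF of $D$. *)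

(* Defs.v *)
From mathcomp Require Import all_boot all_order all_algebra.

Set Implicit Arguments.
Unset Strict Implicit.
Unset Printing Implicit Defensive.

Import Order.TTheory GRing.Theory Num.Theory.

Local Open Scope ring_scope.

Record digraph := Digraph {
  vertex :> finType;
  arcs : {set vertex * vertex};
  arcs_loopless : forall x, (x, x) \notin arcs
}.

Definition out_closed (D : digraph) (u : D) : {set D} :=
  u |: [set v | (u, v) \in arcs D].

Notation pm1 := (seq_sub [:: -1; 1 : int]).

Definition plus_one : pm1 := @SeqSub int [:: -1; 1] 1 isT.

Definition sum_on (V : finType) (f : {ffun V -> pm1}) (X : {set V}) : int :=
  \sum_(v in X) \val (f v).

Definition modf (D : digraph) (f : {ffun D -> pm1}) : bool :=
  (#|D| <= 2 * #|[set v : D | (1 <= sum_on f (out_closed v))%R]|)%N.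

Definition weight (V : finType) (f : {ffun V -> pm1}) : int :=
  sum_on f [set: V].

(* The seed of arg min, the constant function 1, is a MODF (modf_plus_one), so
   the argmin ranges over a nonempty set; see gamma_majP. *)
Definition gamma_maj (D : digraph) : int :=
  weight [arg min_(f < [ffun=> plus_one] | @modf D f) weight f]%O.

Lemma modf_plus_one (D : digraph) : @modf D [ffun=> plus_one].
Proof.
rewrite /modf; set S := [set v | _]; suff -> : S = [set: D].
  by rewrite cardsT leq_pmull.
apply/setP=> v; rewrite !inE /sum_on.
under eq_bigr => w _ do rewrite ffunE.
rewrite sumr_const [val _]/= ler1n card_gt0; apply/set0Pn; exists v.
exact: setU11.
Qed.

Lemma gamma_majP (D : digraph) :
  (exists2 f : {ffun D -> pm1}, modf f & weight f = gamma_maj D) /\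
  (forall f : {ffun D -> pm1}, modf f -> gamma_maj D <= weight f).
Proof.
rewrite /gamma_maj; case: arg_minP => [|f modf_f min_f].
  exact: modf_plus_one.
by split; first by exists f.
Qed.

Definition arcs_rev (D : digraph) (u v : D) : {set D * D} :=
  (arcs D :\ (u, v)) :|: [set (v, u)].

Lemma arcs_rev_loopless (D : digraph) (u v : D) :
  (u, v) \in arcs D -> forall x, (x, x) \notin arcs_rev u v.
Proof.
move=> uv x; rewrite !inE negb_or negb_and (negPf (arcs_loopless x)) orbT /=.
apply/eqP=> -[xv xu]; move: uv; rewrite -xu -xv.
exact/negP/arcs_loopless.
Qed.

Definition reverse_arc (D : digraph) (u v : D) (uv : (u, v) \in arcs D) :
  digraph := Digraph (arcs_rev_loopless uv).

(* Main.v *)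
Require Import Defs.
From mathcomp Require Import all_boot all_order all_algebra.
From mathcomp Require Import zify.

(** Reversing [uv] takes [v] out of [N[u]] and puts [u] into [N[v]].  Given a
    MODF of the old digraph, raise one vertex of value [-1] in the new [N[u]]
    to [1], taking [u] itself if its value is [-1].  This costs 2, makes up for
    the loss of [v] in [N[u]], and ensures that the vertex [u] gained by [N[v]]
    has value [1].  If there is no vertex to raise, [f] is constantly [1] on
    [N[u]] and can be kept.  Undoing the reversal has the same effect on the
    closed neighbourhoods, with [u] and [v] exchanged, except that [N[v]] does
    not change in either direction if [vu] was already an arc.  Sharpness comes
    from the tournaments on three vertices: the cyclic one has [gamma_maj] equal
    to [3], the transitive one [1], and each is an arc reversal of the other. *)

Set Implicit Arguments.
Unset Strict Implicit.
Unset Printing Implicit Defensive.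

Import Order.TTheory GRing.Theory Num.Theory.

Local Open Scope ring_scope.

Lemma pm1_val (a : pm1) : \val a = -1 \/ \val a = 1.
Proof. by case: a => x /=; rewrite !inE => /orP[] /eqP->; [left|right]. Qed.

Section Raise.
Variables (V : finType) (f : {ffun V -> pm1}).

Definition raise (w : V) : {ffun V -> pm1} :=
  [ffun x => if x == w then plus_one else f x].

Lemma raise_le w (X : {set V}) : sum_on f X <= sum_on (raise w) X.
Proof.
apply: ler_sum => x _; rewrite ffunE; case: eqP => // _.
by case: (pm1_val (f x)) => ->.
Qed.

Lemma raise_in w (X : {set V}) :
  \val (f w) = -1 -> w \in X -> sum_on (raise w) X = sum_on f X + 2.
Proof.
move=> fw wX; rewrite /sum_on (bigD1 w wX) [in RHS](bigD1 w wX) /= fw ffunE eqxx.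
rewrite (eq_bigr (fun i => \val (f i))) /= => [|i /andP[_ /negPf iw]]; first lia.
by rewrite ffunE iw.
Qed.

Lemma sum_onD1_ge v (X : {set V}) : sum_on f X - 1 <= sum_on f (X :\ v).
Proof.
case: (boolP (v \in X)) => vX; last first.
  by rewrite (setDidPl _) ?gerBl // disjoint_sym disjoints1.
rewrite /sum_on (big_setD1 v vX) /=.
by rewrite addrAC gerDr; case: (pm1_val (f v)) => /= ->.
Qed.

Lemma sum_onU1_ge u (X : {set V}) :
  \val (f u) = 1 -> sum_on f X <= sum_on f (u |: X).
Proof.
move=> fu; case: (boolP (u \in X)) => uX; first by rewrite (setUidPr _) ?sub1set.
by rewrite /sum_on big_setU1 //= fu lerDr.
Qed.

End Raise.

(** Set families in place of digraphs let one argument serve both directions; the alternative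
    [N2 u = N1 u] arises when a reversal is undone whose opposite arc was already present. *)
Lemma raise_neighbourhoods (V : finType) (N1 N2 : V -> {set V}) (u v : V)
    (f : {ffun V -> pm1}) :
  (forall x, x != u -> x != v -> N2 x = N1 x) -> u \in N2 u ->
  (N2 u = N1 u \/ N2 u = N1 u :\ v) ->
  (N2 v = N1 v \/ N2 v = u |: N1 v) ->
  exists2 g : {ffun V -> pm1}, weight g <= weight f + 2 &
    forall x, 1 <= sum_on f (N1 x) -> 1 <= sum_on g (N2 x).
Proof.
move=> N2x uN2 N2u N2v.
have lossu : sum_on f (N1 u) - 1 <= sum_on f (N2 u).
  by case: N2u => ->; [lia | exact: sum_onD1_ge].
have gainv (g : {ffun V -> pm1}) : \val (g u) = 1 ->
    sum_on g (N1 v) <= sum_on g (N2 v).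
  by case: N2v => -> // gu; exact: sum_onU1_ge.
(* Raising [w] gains 2 on [N2 u] against a loss of at most 1, and with value 1 at [u] the sum around
   [v] cannot drop. *)
have fix_at w : w \in N2 u -> \val (f w) = -1 -> \val (raise f w u) = 1 ->
    exists2 g : {ffun V -> pm1}, weight g <= weight f + 2 &
      forall x, 1 <= sum_on f (N1 x) -> 1 <= sum_on g (N2 x).
  move=> wN fw gu; exists (raise f w); first by rewrite /weight raise_in ?inE.
  move=> x; have [-> | xu] := eqVneq x u.
    by have := raise_in fw wN; lia.
  have [-> | xv] := eqVneq x v; last rewrite N2x //.
    by have := gainv _ gu; have := raise_le f w (N1 v); lia.
  by have := raise_le f w (N1 x); lia.
case: (pm1_val (f u)) => fu.
  by apply: (fix_at u) => //; rewrite ffunE eqxx.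
have [w /andP[wN /eqP fw] | nopm] :=
  pickP (fun w => (w \in N2 u) && (\val (f w) == -1)).
  by apply: (fix_at w) => //; rewrite ffunE; case: eqP.
exists f => [|x]; first lia.
have [-> _ | xu] := eqVneq x u.
  (* Without a value -1 in [N2 u] the sum is its cardinality, positive because of [u]. *)
  rewrite /sum_on (eq_bigr (fun=> 1)) => [|w wN]; last first.
    by case: (pm1_val (f w)) => // fw; move: (nopm w); rewrite wN fw.
  by rewrite sumr_const ler1n card_gt0; apply/set0Pn; exists u.
have [-> | xv] := eqVneq x v; last by rewrite N2x.
by have := gainv _ fu; lia.
Qed.

(** Both digraphs share [V], so a minimum MODF of the first can be altered and read in the second,
    where every good vertex stays good. *)
Lemma gamma_maj_le (V : finType) (A1 A2 : {set V * V}) h1 h2 (u v : V) :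
  let N1 := @out_closed (@Digraph V A1 h1) in
  let N2 := @out_closed (@Digraph V A2 h2) in
  (forall x, x != u -> x != v -> N2 x = N1 x) ->
  (N2 u = N1 u \/ N2 u = N1 u :\ v) ->
  (N2 v = N1 v \/ N2 v = u |: N1 v) ->
  gamma_maj (@Digraph V A2 h2) <= gamma_maj (@Digraph V A1 h1) + 2.
Proof.
move=> N1 N2 N2x N2u N2v.
have [[f modf_f <-] _] := gamma_majP (@Digraph V A1 h1).
have [g le_gf good] :=
  raise_neighbourhoods f N2x (setU11 _ _ : u \in N2 u) N2u N2v.
apply: le_trans le_gf; apply: (proj2 (gamma_majP (@Digraph V A2 h2))).
apply: leq_trans modf_f _; rewrite leq_mul2l /=; apply/subset_leq_card/subsetP.
by move=> x; rewrite !inE; exact: good.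
Qed.

Lemma gamma_maj_eq (D : digraph) (f : {ffun D -> pm1}) :
  modf f -> (forall g : {ffun D -> pm1}, modf g -> weight f <= weight g) ->
  gamma_maj D = weight f.
Proof.
move=> modf_f min_f; have [[g modf_g gE] min_g] := gamma_majP D.
by apply: le_anti; rewrite min_g //= -gE min_f.
Qed.

Lemma gamma_maj_reverse_arc (D : digraph) (u v : D) (uv : (u, v) \in arcs D) :
  gamma_maj D - 2 <= gamma_maj (reverse_arc uv) <= gamma_maj D + 2.
Proof.
case: D u v uv => V A h u v uv.
have /= uv_neq : u != v by apply: contraL uv => /eqP->; exact: h.
have vu_neq : (v == u) = false by rewrite eq_sym; exact: negbTE.
have Nx (x : V) : x != u -> x != v ->
    @out_closed (reverse_arc uv) x = @out_closed (Digraph h) x.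
  move=> xu xv; apply/setP=> w.
  by rewrite !inE /= !xpair_eqE (negPf xu) (negPf xv) orbF.
have Nu : @out_closed (reverse_arc uv) u = @out_closed (Digraph h) u :\ v.
  apply/setP=> w; rewrite !inE /= !xpair_eqE eqxx (negPf uv_neq) orbF /=.
  by have [->|//] := eqVneq w u; rewrite uv_neq.
have Nv : @out_closed (reverse_arc uv) v = u |: @out_closed (Digraph h) v.
  apply/setP=> w; rewrite !inE /= !xpair_eqE eqxx vu_neq /=.
  by rewrite orbA orbC.
apply/andP; split; last first.
  by apply: (@gamma_maj_le V A _ _ _ u v); [|right|right].
(* The original digraph now comes second: [v] loses [u], unless [vu] was an arc before the reversal,
   and [u] regains [v]. *)
rewrite lerBlDr; apply: (@gamma_maj_le V _ A _ _ v u) => [x xv xu||].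
- by rewrite Nx.
- have [vu | vu] := boolP ((v, u) \in A).
    by left; apply/esym; rewrite Nv; apply/setUidPr; rewrite sub1set !inE vu orbT.
  by right; rewrite Nv setU1K // !inE (negPf vu) orbF.
- by right; rewrite Nu setD1K // !inE uv orbT.
Qed.

Lemma sum_out_closed (D : digraph) (f : {ffun D -> pm1}) (x : D) :
  sum_on f (out_closed x) =
  \sum_w (if (w == x) || ((x, w) \in arcs D) then \val (f w) else 0).
Proof. by rewrite /sum_on big_mkcond; apply: eq_bigr => w _; rewrite !inE. Qed.

(** Lifts are the form in which [big_ord_recl] produces these vertices. *)
Definition ord3_1 : 'I_3 := lift ord0 ord0.
Definition ord3_2 : 'I_3 := lift ord0 (lift ord0 ord0).

(** Follows the unfolding of the sums over ['I_3]; with integers as arguments, each of the eight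
    sign patterns is decided by computation. *)
Definition modf3 (e : rel nat) (x0 x1 x2 : int) : bool :=
  let s i := (if (0 == i)%N || e i 0%N then x0 else 0) +
             ((if (1 == i)%N || e i 1%N then x1 else 0) +
              (if (2 == i)%N || e i 2%N then x2 else 0)) in
  (3 <= 2 * ((1 <= s 0%N)%R + ((1 <= s 1%N)%R + (1 <= s 2%N)%R)))%N.

Lemma modf_ord3 (A : {set 'I_3 * 'I_3}) (h : forall x, (x, x) \notin A)
    (e : rel nat) (f : {ffun 'I_3 -> pm1}) :
  (forall i j : 'I_3, ((i, j) \in A) = e i j) ->
  @modf (Digraph h) f =
  modf3 e (\val (f ord0)) (\val (f ord3_1)) (\val (f ord3_2)).
Proof.
move=> Ae; rewrite /modf card_ord -sum1_card big_mkcond /=.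
rewrite !big_ord_recl big_ord0 !inE !(@sum_out_closed (Digraph h)) /=.
rewrite !big_ord_recl !big_ord0.
by rewrite !Ae !addr0 addn0.
Qed.

Lemma weight_ord3 (f : {ffun 'I_3 -> pm1}) :
  weight f = \val (f ord0) + (\val (f ord3_1) + \val (f ord3_2)).
Proof.
rewrite /weight /sum_on big_mkcond /= !big_ord_recl big_ord0 !inE.
by rewrite addr0.
Qed.

Lemma gamma_maj_transitive3 (A : {set 'I_3 * 'I_3})
    (h : forall x, (x, x) \notin A) :
  (forall i j : 'I_3, ((i, j) \in A) = (i < j)%N) -> gamma_maj (Digraph h) = 1.
Proof.
move=> Ae.
(* The value -1 sits at the source, which lies in no other closed out-neighbourhood. With two values
   -1 at most the sink would be good, but two good vertices are needed. *)
pose f : {ffun 'I_3 -> pm1} :=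
  [ffun i => if i == ord0 then @SeqSub int [:: -1; 1] (-1) isT else plus_one].
have fw : weight f = 1 by rewrite weight_ord3 !ffunE.
rewrite -fw; apply: gamma_maj_eq => [|g].
  by rewrite (@modf_ord3 A h ltn f Ae) !ffunE.
rewrite (@modf_ord3 A h ltn g Ae) fw weight_ord3.
by case: (pm1_val (g ord0)) => ->; case: (pm1_val (g ord3_1)) => ->;
   case: (pm1_val (g ord3_2)) => ->.
Qed.

(** Each closed out-neighbourhood has two vertices, so a good one needs value 1 on both; a single -1
    spoils two of the three. *)
Lemma gamma_maj_cyclic3 (A : {set 'I_3 * 'I_3})
    (h : forall x, (x, x) \notin A) :
  (forall i j : 'I_3, ((i, j) \in A) = (j == i.+1 %% 3 :> nat)%N) ->
  gamma_maj (Digraph h) = 3.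
Proof.
move=> Ae.
have fw : weight [ffun _ : 'I_3 => plus_one] = 3 by rewrite weight_ord3 !ffunE.
rewrite -fw; apply: gamma_maj_eq => [|g]; first exact: modf_plus_one.
rewrite (@modf_ord3 A h (fun i j => j == i.+1 %% 3)%N g Ae) fw weight_ord3.
by case: (pm1_val (g ord0)) => ->; case: (pm1_val (g ord3_1)) => ->;
   case: (pm1_val (g ord3_2)) => ->.
Qed.

Lemma transitive3_loopless (x : 'I_3) :
  (x, x) \notin [set p : 'I_3 * 'I_3 | (p.1 < p.2)%N].
Proof. by rewrite inE ltnn. Qed.

Lemma cyclic3_loopless (x : 'I_3) :
  (x, x) \notin [set p : 'I_3 * 'I_3 | (p.2 == p.1.+1 %% 3 :> nat)%N].
Proof. by rewrite inE; case: x => [[|[|[]]]]. Qed.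

Theorem theorem3p8 :
  (forall (D : digraph) (u v : D) (uv : (u, v) \in arcs D),
     gamma_maj D - 2 <= gamma_maj (reverse_arc uv) <= gamma_maj D + 2) /\
  (exists (D : digraph) (u v : D) (uv : (u, v) \in arcs D),
     gamma_maj (reverse_arc uv) = gamma_maj D - 2) /\
  (exists (D : digraph) (u v : D) (uv : (u, v) \in arcs D),
     gamma_maj (reverse_arc uv) = gamma_maj D + 2).
Proof.
split; first exact: gamma_maj_reverse_arc.
split.
  (* Turning the arc from 2 to 0 of the cycle 0, 1, 2 around yields the transitive order. *)
  have uv : (ord3_2, ord0) \in arcs (Digraph cyclic3_loopless) by rewrite inE.
  exists (Digraph cyclic3_loopless), ord3_2, ord0, uv.
  rewrite [LHS]gamma_maj_transitive3 => [|i j].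
    by rewrite gamma_maj_cyclic3 // => i j; rewrite inE.
  by rewrite !inE !xpair_eqE; case: i j => [[|[|[]]]] // ? [[|[|[]]]].
have uv : (ord0, ord3_2) \in arcs (Digraph transitive3_loopless) by rewrite inE.
exists (Digraph transitive3_loopless), ord0, ord3_2, uv.
rewrite [LHS]gamma_maj_cyclic3 => [|i j].
  by rewrite gamma_maj_transitive3 // => i j; rewrite inE.
by rewrite !inE !xpair_eqE; case: i j => [[|[|[]]]] // ? [[|[|[]]]].
Qed.
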